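(* Let $n\ge0$. Assigning to a family its Boolean function gives a bijection between the set of all combinatorially standard combinatorial equivalence classes of monotone families in definable ordered $n$-simplices and the set of all lex-monotone Boolean functions $\{0,1\}^n\to\{0,1\}$.
   Context: Fix an o-minimal structure over $\mathbb R$; ''definable'' means definable in it. Simplices. The standard ordered $n$-simplex is $\Delta^n=\{t\in\mathbb R^n:t_i>0,\ t_1+\cdots+t_n<1\}$, with the vertex at the origin labelled $0$ and the vertex with $t_i=1$ labelled $i$. An ordered definable $n$-simplex is a bounded definable set $\Lambda$ together with a definable homeomorphism $\overline{\Delta^n}\to\overline\Lambda$ carrying $\Delta^n$ to $\Lambda$; faces and labelled vertices of $\Lambda$ are the images of those of $\Delta^n$. $\Lambda_{j_1,\dots,j_k}$ is the (open) face opposite to vertices $j_1,\dots,j_k$. For $A\subset\Lambda$: $A_j:=\overline A\cap\Lambda_j$, $A_{j_1,\dots,j_k}:=\overline{A_{j_1,\dots,j_{k-1}}}\cap\Lambda_{j_1,\dots,j_k}$. When considering restrictions to a face, its vertices are relabelled $0,1,\dots$ preserving order. A property of a family is hereditary if it holds for all restrictions to faces. Families. A monotone family $S_\delta$ in $\Lambda$ is a family of the form $S_\delta\cap\Lambda$, where $\{S_\delta\}_{\delta>0}$ is a definable family of compact subsets of a compact definable set containing $\Lambda$, with $S_\delta\subset S_\eta$ for all sufficiently small $\delta>\eta>0$. ${\rm int}$ denotes interior relative to $\Lambda$. All families are assumed to satisfy, hereditarily and for small $\delta>0$, the conditions: (A) if $S_\delta\ne\emptyset$ then $(S_\delta)_j\ne\emptyset$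 for every $j>0$; (B) if $(S_\delta)_0=\Lambda_0$ then $S_\delta=\Lambda$; (C) $(S_\delta)_{\ell,m}=(S_\delta)_{m,\ell}$ for all $0\le\ell<m\le n$, $(\ell,m)\ne(0,1)$; (D) either $S_\delta=\emptyset$ or $\bigcup_\delta{\rm int}(S_\delta)=\Lambda$. Boolean function of a family: $\psi:\{0,1\}^n\to\{0,1\}$, defined inductively: for $n=0$, $\psi\equiv1$ if $S_\delta=\Lambda$, $\psi\equiv0$ if $S_\delta=\emptyset$; for $n>0$, $\psi|_{x_j=0}$ is assigned to $(S_\delta)_j$ for $j\ne0$ and $\psi|_{x_1=1}$ is assigned to $(S_\delta)_0$. $\psi$ is lex-monotone if it is non-increasing for the lexicographic order on $\{0,1\}^n$ with $x_1<\cdots<x_n$, i.e. with $x_n$ the most significant and $x_1$ the least significant variable. Two families $S_\delta$, $V_\delta$ in definable ordered $n$-simplices are combinatorially equivalent if for every sequence of pairwise distinct $j_1,\dots,j_k\in\{0,\dots,n\}$ (including the empty sequence) the restrictions $(S_\delta)_{j_1,\dots,j_k}$ and $(V_\delta)_{j_1,\dots,j_k}$ are simultaneously empty or non-empty for small $\delta$. A combinatorial equivalence class is combinatorially standard if the corresponding Boolean function (which depends only on the class) is lex-monotone. *)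

(* Defs.v *)
From HB Require Import structures.
From mathcomp Require Import all_boot all_order all_algebra.
From mathcomp Require Import all_classical all_reals all_analysis.
(* Not imported: the notations of mpoly clash with those of the analysis files. *)
From mathcomp.multinomials Require mpoly.

Set Implicit Arguments.
Unset Strict Implicit.
Unset Printing Implicit Defensive.

Import Order.TTheory GRing.Theory Num.Theory.
Import numFieldNormedType.Exports.

Local Open Scope classical_set_scope.
Local Open Scope ring_scope.

Record o_minimal_structure (R : realType) := OMinimalStructure {
  definable : forall n, set (set 'rV[R]_n);
  definable_algebraic : forall n (p : mpoly.mpoly n R),
    definable [set x : 'rV[R]_n | mpoly.meval (x ord0) p = 0];
  definable_setC : forall n (A : set 'rV[R]_n),
    definable A -> definable (~` A);
  definable_setU : forall n (A B : set 'rV[R]_n),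
    definable A -> definable B -> definable (A `|` B);
  definable_setX : forall m n (A : set 'rV[R]_m) (B : set 'rV[R]_n),
    definable A -> definable B ->
    definable [set z : 'rV[R]_(m + n) | A (lsubmx z) /\ B (rsubmx z)];
  definable_proj : forall n (A : set 'rV[R]_(n + 1)),
    definable A -> definable [set lsubmx z | z in A];
  (* Points are the intervals `[a, a]. *)
  definable1P : forall A : set 'rV[R]_1,
    definable A <->
    exists s : seq (interval R), forall x, A x <-> has (fun i => x 0 0 \in i) s
}.

Section DefinableMaps.
Variables (R : realType) (O : o_minimal_structure R).

Definition definable_map n m (A : set 'rV[R]_n) (f : 'rV[R]_n -> 'rV[R]_m) :=
  definable O [set z : 'rV[R]_(n + m) | A (lsubmx z) /\ rsubmx z = f (lsubmx z)].

(* The parameter is the last coordinate of 'rV_(m + 1). *)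
Definition definable_family m (T : R -> set 'rV[R]_m) :=
  definable O [set z : 'rV[R]_(m + 1) | let d := rsubmx z 0 0 in
                                        0 < d /\ T d (lsubmx z)].

End DefinableMaps.

Definition homeomorphism_on (X Y : topologicalType) (A : set X) (B : set Y)
    (f : X -> Y) :=
  [/\ set_bij A B f, {within A, continuous f} &
      exists g : Y -> X, (forall x, A x -> g (f x) = x) /\
                         {within B, continuous g}].

Definition std_simplex (R : realType) n : set 'rV[R]_n :=
  [set t | (forall i, 0 < t 0 i) /\ \sum_i t 0 i < 1].

(* Barycentric coordinates: vertex 0 is the origin, and vertex [lift ord0 i],
   whose value is [i + 1], is the point with i-th coordinate 1. *)
Definition bary (R : realType) n (t : 'rV[R]_n) (j : 'I_n.+1) : R :=
  if unlift ord0 j is Some i then t 0 i else 1 - \sum_i t 0 i.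

(* The open face opposite to the vertices of [js]; it is empty when [js]
   contains every vertex. *)
Definition std_face (R : realType) n (js : seq 'I_n.+1) : set 'rV[R]_n :=
  [set t | forall j, if j \in js then bary t j = 0 else 0 < bary t j].

Record ordered_simplex (R : realType) (O : o_minimal_structure R) (n m : nat) :=
  OrderedSimplex {
    carrier :> set 'rV[R]_m;
    chart : 'rV[R]_n -> 'rV[R]_m;
    carrier_bounded : bounded_set carrier;
    carrier_definable : definable O carrier;
    chart_definable : definable_map O (closure (@std_simplex R n)) chart;
    chart_homeomorphism :
      homeomorphism_on (closure (@std_simplex R n)) (closure carrier) chart;
    chart_simplex : chart @` @std_simplex R n = carrier
  }.

Section Restrictions.
Variables (R : realType) (O : o_minimal_structure R) (n m : nat).
Variable L : ordered_simplex O n m.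

Definition face (js : seq 'I_n.+1) : set 'rV[R]_m := chart L @` @std_face R n js.

(* [restr_from js A [:: k_1; ...; k_r]], for A a subset of the face opposite to
   [js], successively replaces A by the trace of its closure on the faces
   opposite to [js, k_1], [js, k_1, k_2], etc. *)
Fixpoint restr_from (js : seq 'I_n.+1) (A : set 'rV[R]_m) (ks : seq 'I_n.+1) :=
  if ks is k :: ks' then
    restr_from (rcons js k) (closure A `&` face (rcons js k)) ks'
  else A.

(* A_{j_1, ..., j_k}; the order of the sequence matters. *)
Definition restr (A : set 'rV[R]_m) (js : seq 'I_n.+1) := restr_from [::] A js.

(* The vertex relabelled i in the face opposite to [js], for i <= n - size js. *)
Definition vertex (js : seq 'I_n.+1) (i : nat) : 'I_n.+1 :=
  nth ord0 [seq v <- enum 'I_n.+1 | v \notin js] i.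

Definition relative_interior (X A : set 'rV[R]_m) : set 'rV[R]_m :=
  [set x | X x /\ within X (nbhs x) A].

(* Only the values at positive parameters are meaningful. *)
Definition monotone_family (S : R -> set 'rV[R]_m) :=
  exists (K : set 'rV[R]_m) (T : R -> set 'rV[R]_m),
  [/\ [/\ compact K, definable O K & L `<=` K],
      forall d, 0 < d -> compact (T d) /\ T d `<=` K,
      definable_family O T,
      \forall d \near 0^'+, forall e, 0 < e -> e < d -> T d `<=` T e &
      forall d, 0 < d -> S d = T d `&` L].

Variables (S : R -> set 'rV[R]_m) (js : seq 'I_n.+1).

(* Conditions (A)-(D) for the restriction of S to the face opposite to js, whose
   dimension is n - size js. *)

Definition condA := \forall d \near 0^'+,
  restr (S d) js !=set0 ->
  forall j, (0 < j <= n - size js)%N ->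
    restr (S d) (rcons js (vertex js j)) !=set0.

(* Vacuous on vertices, which have no facets. *)
Definition condB := (0 < n - size js)%N -> \forall d \near 0^'+,
  restr (S d) (rcons js (vertex js 0)) = face (rcons js (vertex js 0)) ->
  restr (S d) js = face js.

Definition condC := \forall d \near 0^'+,
  forall l k, (l < k <= n - size js)%N -> (l, k) != (0%N, 1%N) ->
    restr (S d) (js ++ [:: vertex js l; vertex js k]) =
    restr (S d) (js ++ [:: vertex js k; vertex js l]).

(* As with the other conditions, only small parameters enter the union. *)
Definition condD :=
  (\forall d \near 0^'+, restr (S d) js = set0) \/
  (\forall e \near 0^'+,
     \bigcup_(d in `]0, e[) relative_interior (face js) (restr (S d) js) =
     face js).

End Restrictions.

Record mfamily (R : realType) (O : o_minimal_structure R) (n : nat) := MFamily {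
  ambient_dim : nat;
  simplex : ordered_simplex O n ambient_dim;
  fam :> R -> set 'rV[R]_ambient_dim;
  fam_monotone : monotone_family simplex fam;
  fam_hereditary : forall js : seq 'I_n.+1, uniq js -> (size js <= n)%N ->
    [/\ condA simplex fam js, condB simplex fam js,
        condC simplex fam js & condD simplex fam js]
}.

(* The variable x_i is the coordinate of index i - 1. *)
Definition boolfun n := {ffun 'I_n -> bool} -> bool.

Definition insert_var n (i : 'I_n.+1) (b : bool) (x : {ffun 'I_n -> bool}) :
    {ffun 'I_n.+1 -> bool} :=
  [ffun k => if unlift i k is Some k' then x k' else b].

Definition fix_var n (i : 'I_n.+1) (b : bool) (psi : boolfun n.+1) : boolfun n :=
  fun x => psi (insert_var i b x).

(* The most significant variable is the one of largest index. *)
Definition lex_lt n (x y : {ffun 'I_n -> bool}) :=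
  exists i : 'I_n, [/\ x i = false, y i = true &
                       forall k : 'I_n, (i < k)%N -> x k = y k].

Definition lex_monotone n : set (boolfun n) :=
  [set psi | forall x y, lex_lt x y -> psi y -> psi x].

Section Families.
Variables (R : realType) (O : o_minimal_structure R) (n : nat).

(* [psi] is a Boolean function of the restriction of F to the p-dimensional face
   opposite to [js] (so size js + p = n). *)
Fixpoint is_boolfun_at (F : mfamily O n) (p : nat) (js : seq 'I_n.+1) :
    boolfun p -> Prop :=
  match p return boolfun p -> Prop with
  | 0%N => fun psi =>
      ((\forall d \near 0^'+, restr (simplex F) (F d) js = face (simplex F) js) /\
       psi = fun=> true) \/
      ((\forall d \near 0^'+, restr (simplex F) (F d) js = set0) /\
       psi = fun=> false)
  | p'.+1 => fun psi =>
      (forall i : 'I_p'.+1,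
         is_boolfun_at F (rcons js (vertex js i.+1)) (fix_var i false psi)) /\
      is_boolfun_at F (rcons js (vertex js 0)) (fix_var ord0 true psi)
  end.

Definition is_boolfun (F : mfamily O n) (psi : boolfun n) :=
  is_boolfun_at F [::] psi.

Definition comb_equiv (F G : mfamily O n) :=
  forall js : seq 'I_n.+1, uniq js ->
    \forall d \near 0^'+, restr (simplex F) (F d) js = set0 <->
                          restr (simplex G) (G d) js = set0.

Definition comb_class (F : mfamily O n) : set (mfamily O n) :=
  [set G | comb_equiv F G].

Definition comb_standard_classes : set (set (mfamily O n)) :=
  [set C | exists F psi,
     [/\ C = comb_class F, is_boolfun F psi & lex_monotone psi]].

End Families.

(* Main.v *)
(** By (A), a trace of a family is nonempty iff so is its trace on the vertex
reached by always removing the second lowest remaining vertex, that is, iff its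
Boolean function is 1 at the origin. The Boolean function of a trace is a
restriction of that of the family, since by (C) the order of the removals matters
only for the two lowest vertices; so it determines the combinatorial class, and
conversely.

For surjectivity only coordinatewise antitonicity of psi is needed. In barycentric
coordinates t_0, ..., t_n let x_v be the open condition "t_u < d t_v for every
u < v", and put S_d = {t | psi (x_1, ..., x_n) = 1}. Near the facet t_k = 0, the
variable x_k is 0 if some vertex below k remains; if k is the lowest remaining
vertex, then the variable of the next one is 1; the other variables keep their
definition. Hence the traces are sets of the same kind, with psi restricted
accordingly, and (A)-(D) can be read off. *)

Require Import Defs.
From HB Require Import structures.
From mathcomp Require Import all_boot all_order all_algebra.
From mathcomp Require Import all_classical all_reals all_analysis.
From mathcomp.multinomials Require mpoly.
From mathcomp Require Import zify ring lra.

Set Implicit Arguments.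
Unset Strict Implicit.
Unset Printing Implicit Defensive.

Import Order.TTheory GRing.Theory Num.Theory.
Import numFieldNormedType.Exports.
Import (canonicals) mpoly.

Local Open Scope classical_set_scope.
Local Open Scope ring_scope.

(** * Vertices and Boolean functions *)

Section Vertices.
Local Open Scope nat_scope.
Variable n : nat.
Implicit Types (js : seq 'I_n.+1) (k v : 'I_n.+1).

Definition complement js := [seq v <- enum 'I_n.+1 | v \notin js].

Lemma mem_complement js v : (v \in complement js) = (v \notin js).
Proof. by rewrite mem_filter mem_enum andbT. Qed.

Lemma uniq_complement js : uniq (complement js).
Proof. by rewrite filter_uniq // enum_uniq. Qed.

Lemma size_complement js : uniq js -> size (complement js) = n.+1 - size js.
Proof.
move=> /card_uniqP <-; 
rewrite -[X in X - _](card_ord n.+1) -(cardC (mem js)) addKn cardE.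
by rewrite /enum_mem -enumT.
Qed.

Lemma sorted_complement js :
  sorted (fun u v : 'I_n.+1 => u < v) (complement js).
Proof.
apply: sorted_filter; first by move=> x y z; apply: ltn_trans.
by have := iota_ltn_sorted 0 n.+1; rewrite -val_enum_ord sorted_map.
Qed.

Lemma vertex_notin js i : uniq js -> i + size js <= n -> vertex js i \notin js.
Proof.
move=> ujs le_in; rewrite -mem_complement mem_nth //.
by rewrite size_complement // ltn_subRL addnC ltnS.
Qed.

Lemma vertex_lt js i j : uniq js -> i < j -> j + size js <= n ->
  vertex js i < vertex js j.
Proof.
move=> ujs lt_ij le_jn.
have lt_j : j < size (complement js).
  by rewrite size_complement // ltn_subRL addnC ltnS.
apply: (sorted_ltn_nth _ _ (sorted_complement js)) => //.
  by move=> x y z; apply: ltn_trans.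
by rewrite inE (ltn_trans lt_ij).
Qed.

Lemma vertex_onto js k : uniq js -> k \notin js ->
  exists2 i, i + size js <= n & k = vertex js i.
Proof.
move=> ujs; rewrite -mem_complement => /(nthP ord0)[i lt_i <-]; exists i => //.
by move: lt_i; rewrite size_complement // ltn_subRL addnC ltnS.
Qed.

Lemma vertex0_le js k : uniq js -> k \notin js -> vertex js 0 <= k.
Proof.
move=> ujs /(vertex_onto ujs)[[|i] le_in ->] //.
exact/ltnW/vertex_lt.
Qed.

Lemma eq_vertex js js' i : js =i js' -> vertex js i = vertex js' i.
Proof.
by move=> eqj; congr nth; apply: eq_filter => v; rewrite eqj.
Qed.

Lemma complement_rcons js j : uniq js -> j + size js <= n ->
  complement (rcons js (vertex js j)) =
  take j (complement js) ++ drop j.+1 (complement js).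
Proof.
move=> ujs le_jn.
have lt_j : j < size (complement js).
  by rewrite size_complement // ltn_subRL addnC ltnS.
rewrite -[in RHS](index_uniq ord0 lt_j (uniq_complement js)) -remE.
rewrite rem_filter ?uniq_complement // -filter_predI.
by apply: eq_filter => v; rewrite mem_rcons inE negb_or.
Qed.

Lemma vertex_rcons_lt js i j : uniq js -> i < j -> j + size js <= n ->
  vertex (rcons js (vertex js j)) i = vertex js i.
Proof.
move=> ujs lt_ij le_jn; rewrite {1}/vertex -/(complement _).
rewrite complement_rcons // nth_cat size_take.
have lt_j : j < size (complement js).
  by rewrite size_complement // ltn_subRL addnC ltnS.
by rewrite lt_j lt_ij nth_take.
Qed.

Lemma vertex_rcons_ge js i j : uniq js -> j <= i -> j + size js <= n ->
  vertex (rcons js (vertex js j)) i = vertex js i.+1.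
Proof.
move=> ujs le_ji le_jn; rewrite {1}/vertex -/(complement _).
rewrite complement_rcons // nth_cat size_take.
have lt_j : j < size (complement js).
  by rewrite size_complement // ltn_subRL addnC ltnS.
by rewrite lt_j ltnNge le_ji /= nth_drop addSn subnKC.
Qed.

End Vertices.

(** * Boolean functions read off along removals of vertices *)

Section BooleanValue.
Local Open Scope nat_scope.

Definition tail_var p (x : {ffun 'I_p.+1 -> bool}) : {ffun 'I_p -> bool} :=
  [ffun k => x (lift ord0 k)].

Lemma insert_var0 p b (x : {ffun 'I_p -> bool}) : insert_var ord0 b x ord0 = b.
Proof. by rewrite ffunE unlift_none. Qed.

Lemma tail_insert_var0 p b (x : {ffun 'I_p -> bool}) :
  tail_var (insert_var ord0 b x) = x.
Proof. by apply/ffunP => k; rewrite !ffunE liftK. Qed.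

Lemma insert_var_head_tail p (x : {ffun 'I_p.+1 -> bool}) :
  insert_var ord0 (x ord0) (tail_var x) = x.
Proof.
by apply/ffunP => k; rewrite !ffunE; case: unliftP => [j|] ->; rewrite ?ffunE.
Qed.

Lemma insert_var_lift0 p (i : 'I_p.+1) b (x : {ffun 'I_p.+1 -> bool}) :
  insert_var (lift ord0 i) b x ord0 = x ord0.
Proof.
have E : ord0 = lift (lift ord0 i) (ord0 : 'I_p.+1) by apply: val_inj.
by rewrite ffunE {2}E liftK.
Qed.

Lemma tail_insert_var_lift p (i : 'I_p.+1) b (x : {ffun 'I_p.+1 -> bool}) :
  tail_var (insert_var (lift ord0 i) b x) = insert_var i b (tail_var x).
Proof.
apply/ffunP => k; rewrite !ffunE; case: (unliftP i k) => [j|] ->.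
  have -> : lift ord0 (lift i j) = lift (lift ord0 i) (lift ord0 j).
    by apply: val_inj; rewrite /= /bump /= ltnS addnCA.
  by rewrite liftK ffunE.
by rewrite unlift_none.
Qed.

Variable n : nat.
Implicit Types (E : seq 'I_n.+1 -> bool) (js rest : seq 'I_n.+1).

(* Each variable removes one of the two lowest remaining vertices, so that p
   variables lead from the face opposite to js to one of its vertices. *)
Fixpoint boolval E p js : boolfun p :=
  if p is p'.+1 return boolfun p
  then fun x => boolval E (rcons js (vertex js (~~ x ord0))) (tail_var x)
  else fun _ => E js.

(** What (C) leaves when only nonemptiness of traces is kept; [rest] allows arbitrary further
    removals after the exchange. *)
Definition swap_invariant E := forall js l k rest, uniq js -> l < k ->
  k + size js <= n -> (l, k) != (0, 1) ->
  E (js ++ [:: vertex js l; vertex js k] ++ rest) =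
  E (js ++ [:: vertex js k; vertex js l] ++ rest).

(** Since [vertex] depends only on the set of removed vertices, both recursions append the same
    vertex, and the exchange persists with a longer [rest]. *)
Lemma boolval_swap E p js l k rest : swap_invariant E -> uniq js -> l < k ->
  k + size js <= n -> (l, k) != (0, 1) ->
  @boolval E p (js ++ [:: vertex js l; vertex js k] ++ rest) =1
  @boolval E p (js ++ [:: vertex js k; vertex js l] ++ rest).
Proof.
move=> swE ujs lt_lk le_kn neq; elim: p rest => [|p IHp] rest x /=.
  exact: swE.
set v := vertex (_ ++ _) _; set v' := vertex (_ ++ _) _.
have -> : v = v'.
  apply: eq_vertex => u; rewrite !mem_cat; congr orb.
  by rewrite !inE !orbA [(_ == _) || _]orbC.
rewrite !rcons_cat; exact: IHp (rcons rest v') _.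
Qed.

Lemma boolvalS E p js (x : {ffun 'I_p.+1 -> bool}) : boolval E js x =
  boolval E (rcons js (vertex js (~~ x ord0))) (tail_var x).
Proof. by []. Qed.

Lemma boolval_insert_true E p js x : @boolval E p.+1 js (insert_var ord0 true x) =
  boolval E (rcons js (vertex js 0)) x.
Proof. by rewrite /= insert_var0 tail_insert_var0. Qed.

(** The recursion removes only the two lowest vertices, so a higher vertex must be moved to the
    front, past the removal caused by the first variable. One exchanged label is at most 1 and the
    other at least 2, so the excluded pair (0, 1) never occurs. *)
Lemma boolval_insert_false E p js (i : 'I_p.+1) x : swap_invariant E ->
    uniq js -> p.+1 + size js = n ->
  boolval E js (insert_var i false x) =
  boolval E (rcons js (vertex js i.+1)) x.
Proof.
move=> swE; elim: p js i x => [|p IHp] js i x ujs eqn.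
  by case: (unliftP ord0 i) => [[]|] // ->; rewrite /= insert_var0.
case: (unliftP ord0 i) => [{}i|] ->; last first.
  by rewrite /= insert_var0 tail_insert_var0.
rewrite boolvalS insert_var_lift0 tail_insert_var_lift.
(* As a number: the value 1 of the first variable removes the lowest vertex, the value 0 the second
   lowest. *)
set a : nat := ~~ x ord0.
have le_a1 : a <= 1 by rewrite /a; case: (x ord0).
have lt_i : i < p.+1 := ltn_ord i.
have le_an : a + size js <= n by move: eqn; lia.
have le_i2 : i.+2 + size js <= n by move: eqn; lia.
rewrite IHp; first last.
- by rewrite size_rcons -addSnnS.
- by rewrite rcons_uniq ujs vertex_notin.
rewrite vertex_rcons_ge //; last exact: leq_trans le_a1 _.
rewrite [RHS]boolvalS vertex_rcons_lt // -/a; last exact: leq_ltn_trans le_a1 _.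
have := @boolval_swap E p js a i.+2 [::] swE ujs _ le_i2 _ (tail_var x).
rewrite -!cats1 -!catA; apply=> //.
  exact: leq_ltn_trans le_a1 _.
by rewrite xpair_eqE andbF.
Qed.

(** At the origin every step removes the second lowest vertex; the hypothesis on [E] will come from
    (A). *)
Lemma boolval_zero E p js :
    (forall js, uniq js -> size js < n -> E js = E (rcons js (vertex js 1))) ->
    uniq js -> p + size js = n ->
  @boolval E p js [ffun=> false] = E js.
Proof.
move=> E1; elim: p js => [//|p IHp] js ujs eqn /=.
have -> : tail_var [ffun=> false] = [ffun=> false] :> {ffun 'I_p -> bool}.
  by apply/ffunP => k; rewrite !ffunE.
have le1 : 1 + size js <= n by move: eqn; lia.
rewrite ffunE /= IHp ?size_rcons -?addSnnS //; first by rewrite -E1.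
by rewrite rcons_uniq ujs vertex_notin.
Qed.

(** Removing the lowest vertex sets the first variable to 1, and removing the vertex labelled i + 1
    sets the variable of index i to 0. By induction on [js], the function on the whole simplex thus
    determines the one on every face. *)
Lemma boolval_eq_faces E E' p js : swap_invariant E -> swap_invariant E' ->
    @boolval E n [::] =1 @boolval E' n [::] -> uniq js -> p + size js = n ->
  @boolval E p js =1 @boolval E' p js.
Proof.
move=> swE swE' eqE; elim/last_ind: js p => [|js k IHjs] p.
  by rewrite addn0 => _ ->.
rewrite rcons_uniq size_rcons -addSnnS => /andP[kjs ujs] eqn x.
have [[|i] le_in ->] := vertex_onto ujs kjs.
  by rewrite -!boolval_insert_true IHjs.
have lt_i : i < p.+1 by move: eqn le_in; lia.
by rewrite -!(@boolval_insert_false _ _ _ (Ordinal lt_i)) // IHjs.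
Qed.

End BooleanValue.

(** * Faces and traces *)

Section StandardFaces.
Variables (R : realType) (n : nat).
Implicit Types (t : 'rV[R]_n) (w : 'I_n.+1 -> R) (js : seq 'I_n.+1).

Lemma bary0 t : bary t ord0 = 1 - \sum_i t 0 i.
Proof. by rewrite /bary unlift_none. Qed.

Lemma bary_lift t i : bary t (lift ord0 i) = t 0 i.
Proof. by rewrite /bary liftK. Qed.

Lemma sum_bary t : \sum_j bary t j = 1.
Proof.
rewrite big_ord_recl bary0 (eq_bigr _ (fun i _ => bary_lift t i)).
by rewrite subrK.
Qed.

Lemma bary_inj t t' : bary t =1 bary t' -> t = t'.
Proof. by move=> eq_t; apply/rowP => i; rewrite -!bary_lift eq_t. Qed.

Definition bary_point w : 'rV[R]_n := \row_i w (lift ord0 i).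

Lemma bary_pointK w : \sum_j w j = 1 -> bary (bary_point w) =1 w.
Proof.
move=> sumw j; case: (unliftP ord0 j) => [i|] ->.
  by rewrite bary_lift mxE.
rewrite bary0 -sumw big_ord_recl.
have -> : \sum_i bary_point w 0 i = \sum_i w (lift ord0 i).
  by apply: eq_bigr => i _; rewrite mxE.
by rewrite addrK.
Qed.

Lemma std_simplexE : std_face [::] = @std_simplex R n.
Proof.
apply/seteqP; split => t /= ft.
  split=> [i|]; first by have := ft (lift ord0 i); rewrite bary_lift.
  by have := ft ord0; rewrite bary0 subr_gt0.
move=> j; rewrite in_nil; case: ft => t_gt0 sumt; case: (unliftP ord0 j) => [i|] ->.
  by rewrite bary_lift.
by rewrite bary0 subr_gt0.
Qed.

Lemma bary_in t js j : std_face js t -> j \in js -> bary t j = 0.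
Proof. by move=> /(_ j) + jjs; rewrite jjs. Qed.

Lemma bary_notin t js j : std_face js t -> j \notin js -> 0 < bary t j.
Proof. by move=> /(_ j) + jjs; rewrite (negPf jjs). Qed.

Lemma bary_ge0 t js j : std_face js t -> 0 <= bary t j.
Proof. by move=> /(_ j); case: ifP => _ => [->|/ltW]. Qed.

Lemma eq_std_face js js' : js =i js' -> std_face js = @std_face R n js'.
Proof.
by move=> eqj; apply/seteqP; split=> t ft j; have := ft j; rewrite eqj.
Qed.

(** The weights are normalized to have sum 1. The factor [c] is harmless, as the inequalities to be
    tested are homogeneous in the barycentric coordinates; [k] makes the total weight positive. *)
Lemma std_face_weights js w k : k \notin js ->
    (forall j, j \notin js -> 0 < w j) ->
  exists2 c, 0 < c & exists2 t, std_face js t &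
    forall j, j \notin js -> bary t j = c * w j.
Proof.
move=> kjs w_gt0.
have s_gt0 : 0 < \sum_(j | j \notin js) w j.
  rewrite (bigD1 k) //= ltr_pwDl ?w_gt0 //.
  by apply: sumr_ge0 => j /andP[jjs _]; rewrite ltW ?w_gt0.
set s := \sum_(j | _) _ in s_gt0.
have bE : bary (bary_point (fun j => if j \in js then 0 else s^-1 * w j)) =1
    (fun j => if j \in js then 0 else s^-1 * w j).
  apply: bary_pointK; rewrite (bigID (mem js)) /= big1 => [|j ->] //.
  rewrite add0r (eq_bigr (fun j => s^-1 * w j)) => [|j /negPf-> //].
  by rewrite -mulr_sumr mulVf // gt_eqF.
exists s^-1; first by rewrite invr_gt0.
exists (bary_point (fun j => if j \in js then 0 else s^-1 * w j)).
  by move=> j; rewrite bE; case: (boolP (j \in js)) => // jjs; rewrite mulr_gt0 ?invr_gt0 ?w_gt0.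
by move=> j /negPf jjs; rewrite bE jjs.
Qed.

Lemma std_face_neq0 js : uniq js -> (size js <= n)%N -> @std_face R n js !=set0.
Proof.
move=> ujs le_n; have vjs := vertex_notin (i := 0) ujs le_n.
have [//|c _ [t ft _]] := @std_face_weights js (fun=> 1) _ vjs.
by exists t.
Qed.

Lemma std_face_vertex js t t' : uniq js -> size js = n ->
  std_face js t -> std_face js t' -> t = t'.
Proof.
move=> ujs sjs ft ft'.
have vE j : j \notin js -> j = vertex js 0.
  move=> /(vertex_onto ujs)[[//|i]]; rewrite sjs; lia.
have v1 (u : 'rV[R]_n) : std_face js u -> bary u (vertex js 0) = 1.
  move=> fu; rewrite -(sum_bary u) (bigD1 (vertex js 0)) //= big1 ?addr0 // => j.
  by move=> /eqP jv; apply: bary_in fu _; apply: contra_notT jv => /vE.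
apply: bary_inj => j; have [jjs|/vE ->] := boolP (j \in js).
  by rewrite !(bary_in _ jjs).
by rewrite !v1.
Qed.

Lemma std_face_full js : uniq js -> size js = n.+1 -> @std_face R n js = set0.
Proof.
move=> ujs sjs; rewrite -subset0 => t ft; have := sum_bary t.
have jsT j : j \in js.
  by apply: contraT => /(vertex_onto ujs)[i]; rewrite sjs addnS ltnNge leq_addl.
by rewrite big1 => [|j _]; [move/esym/eqP; rewrite oner_eq0|exact: bary_in ft (jsT j)].
Qed.

End StandardFaces.

Lemma near0_rightP (R : realType) (P : set R) :
  (\forall d \near 0^'+, P d) <->
  exists2 e, 0 < e & forall d, 0 < d -> d < e -> P d.
Proof.
split=> [[e /= e0 eP]|[e e0 eP]].
  exists e => // d d0 de; apply: eP => //=.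
  by rewrite /ball_ /= sub0r normrN gtr0_norm.
exists e => //= d; rewrite /ball_ /= sub0r normrN => de d0; apply: eP => //.
by rewrite -(gtr0_norm d0).
Qed.

Section Restriction.
Variables (R : realType) (O : o_minimal_structure R) (n m : nat).
Variable L : ordered_simplex O n m.
Implicit Types (A B : set 'rV[R]_m) (js ks : seq 'I_n.+1).

Lemma restr_from_cat js A ks ks' :
  restr_from L js A (ks ++ ks') =
  restr_from L (js ++ ks) (restr_from L js A ks) ks'.
Proof.
elim: ks js A => [|k ks IHks] js A /=; first by rewrite cats0.
by rewrite IHks cat_rcons.
Qed.

Lemma restr_rcons A js k :
  restr L A (rcons js k) = closure (restr L A js) `&` face L (rcons js k).
Proof. by rewrite /restr -{1}cats1 restr_from_cat. Qed.

Lemma eq_face js js' : js =i js' -> face L js = face L js'.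
Proof. by move=> eqj; rewrite /face (eq_std_face _ eqj). Qed.

Lemma eq_restr_from js js' A ks :
  js =i js' -> restr_from L js A ks = restr_from L js' A ks.
Proof.
elim: ks js js' A => [//|k ks IHks] js js' A eqj /=.
have eqk : rcons js k =i rcons js' k by move=> v; rewrite !mem_rcons !inE eqj.
by rewrite (eq_face eqk); apply: IHks.
Qed.

Lemma sub_restr_from js A B ks :
  A `<=` B -> restr_from L js A ks `<=` restr_from L js B ks.
Proof.
elim: ks js A B => [//|k ks IHks] js A B sAB /=.
by apply: IHks; apply: setSI; apply: closureS.
Qed.

Lemma face_nil : face L [::] = L.
Proof. by rewrite /face std_simplexE chart_simplex. Qed.

Lemma restr_sub_face A js : A `<=` L -> restr L A js `<=` face L js.
Proof.
move=> sAL; case/lastP: js => [|js k]; first by rewrite face_nil.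
by rewrite restr_rcons; apply: subIsetr.
Qed.

Lemma face_neq0 js : uniq js -> (size js <= n)%N -> face L js !=set0.
Proof.
by move=> ujs sjs; have [t ft] := std_face_neq0 R ujs sjs; exists (chart L t), t.
Qed.

(** The face is a single point, so at the bottom of the recursion nonempty means full. *)
Lemma restr_vertex A js : A `<=` L -> uniq js -> size js = n ->
  restr L A js !=set0 -> restr L A js = face L js.
Proof.
move=> sAL ujs sjs [a Aa]; apply/seteqP; split; first exact: restr_sub_face.
have [t ft ta] := restr_sub_face sAL Aa.
by move=> _ [t' ft' <-]; rewrite (std_face_vertex ujs sjs ft' ft) ta.
Qed.

End Restriction.

(** * The Boolean function of a family *)

Section FamilyBooleanFunction.
Variables (R : realType) (O : o_minimal_structure R) (n : nat).
Implicit Types (F G : mfamily O n) (js rest : seq 'I_n.+1).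

Lemma fam_sub F d : 0 < d -> F d `<=` simplex F.
Proof.
by move=> d0; have [K [T [_ _ _ _ ->]]] := fam_monotone F => // x [].
Qed.

Lemma fam_near_decreasing F :
  \forall d \near 0^'+, forall e, 0 < e -> e < d -> F d `<=` F e.
Proof.
have [K [T [_ _ _ Tmono FE]]] := fam_monotone F.
near=> d => e e0 ed; rewrite !FE //.
apply: setSI; move: e e0 ed; near: d; exact: Tmono.
Unshelve. all: end_near. Qed.

(** Members grow as the parameter decreases, so a nonempty trace at one small parameter gives
    nonempty traces at all smaller ones. *)
Lemma restr_dichotomy F js :
  (\forall d \near 0^'+, restr (simplex F) (F d) js !=set0) \/
  (\forall d \near 0^'+, restr (simplex F) (F d) js = set0).
Proof.
have [d0 d0_gt0 decr] := (near0_rightP _).1 (fam_near_decreasing F).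
have [[d [d_gt0 lt_d [x Fx]]]|empty] := pselect (exists d,
    [/\ 0 < d, d < d0 & restr (simplex F) (F d) js !=set0]).
  left; apply/near0_rightP; exists d => // e e0 ed.
  by exists x; move: x Fx; apply: sub_restr_from; apply: decr.
right; apply/near0_rightP; exists d0 => // d d_gt0 lt_d.
by apply: contra_notP empty => /eqP/set0P; exists d.
Qed.

Definition eventually_nonempty F js :=
  `[< \forall d \near 0^'+, restr (simplex F) (F d) js !=set0 >].

(** (C) equates the traces after the two removals; later traces depend only on this trace and on the
    set of vertices removed so far. *)
Lemma eventually_nonempty_swap F : swap_invariant (eventually_nonempty F).
Proof.
move=> js l k rest ujs lt_lk le_kn neq.
have sjs : (size js <= n)%N by apply: leq_trans le_kn; rewrite leq_addl.
have [_ _ condC_F _] := fam_hereditary F ujs sjs.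
have eqr : \forall d \near 0^'+,
    restr (simplex F) (F d) (js ++ [:: vertex js l; vertex js k] ++ rest) =
    restr (simplex F) (F d) (js ++ [:: vertex js k; vertex js l] ++ rest).
  near=> d; rewrite /restr !catA !(restr_from_cat _ _ _ (_ ++ [:: _; _])).
  have -> : restr_from (simplex F) [::] (F d) (js ++ [:: vertex js l; vertex js k]) =
      restr_from (simplex F) [::] (F d) (js ++ [:: vertex js k; vertex js l]).
    have le_k : (l < k <= n - size js)%N by rewrite lt_lk leq_subRL // addnC.
    by move: l k {lt_lk le_kn} le_k neq; near: d.
  by apply: eq_restr_from => v; rewrite !mem_cat !inE [(_ == _) || _]orbC.
by apply: asbool_equiv_eq; split; apply: filterS2 eqr => d ->.
Unshelve. all: end_near. Qed.

(** One direction is (A) for the vertex labelled 1. Conversely, a trace lies in the closure of the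
    set it is taken from, so the latter is nonempty if the trace is. *)
Lemma eventually_nonempty_vertex1 F js : uniq js -> (size js < n)%N ->
  eventually_nonempty F js = eventually_nonempty F (rcons js (vertex js 1)).
Proof.
move=> ujs sjs; have [condA_F _ _ _] := fam_hereditary F ujs (ltnW sjs).
apply: asbool_equiv_eq; split.
  by apply: filterS2 condA_F => d + ne; apply=> //; rewrite subn_gt0.
apply: filterS => d; rewrite restr_rcons => -[x [clx _]].
by apply: contrapT => /nonemptyPn A0; move: clx; rewrite A0 closure0.
Qed.

(** [comb_equiv] also ranges over sequences containing all n + 1 vertices, for which the face is
    empty. *)
Lemma eventually_nonempty_full F js : uniq js -> size js = n.+1 ->
  eventually_nonempty F js = false.
Proof.
move=> ujs sjs; apply/asboolP => /near0_rightP[e e0 ne].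
have e2 : 0 < e / 2 by rewrite divr_gt0.
have [|x] := ne _ e2; first by rewrite ltr_pdivrMr // ltr_pMr // ltr1n.
move=> /(restr_sub_face (fam_sub e2)).
by rewrite /face std_face_full // image_set0.
Qed.

Lemma eventually_nonemptyNP F js :
  ~~ eventually_nonempty F js <->
  (\forall d \near 0^'+, restr (simplex F) (F d) js = set0).
Proof.
split=> [/asboolP|empty]; first by case: (restr_dichotomy F js).
apply/asboolP => ne; near (0:R)^'+ => d.
have [x] : restr (simplex F) (F d) js !=set0 by near: d.
have -> : restr (simplex F) (F d) js = set0 by near: d.
by [].
Unshelve. all: end_near. Qed.

(** By the dichotomy both sides are eventually constant, so an eventual equivalence becomes an
    equality of Booleans. *)
Lemma comb_equivP F G : comb_equiv F G <->
  (forall js, uniq js -> eventually_nonempty F js = eventually_nonempty G js).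
Proof.
split=> [eqFG js ujs|eqFG js ujs].
  apply: negb_inj; apply/idP/idP => /eventually_nonemptyNP E0; apply/eventually_nonemptyNP;
    by apply: filterS2 E0 (eqFG js ujs) => d ? [? ?]; auto.
have [neF|] := boolP (eventually_nonempty F js).
  have neG := neF; rewrite eqFG // in neG.
  move/asboolP: neF => neF; move/asboolP: neG => neG.
  apply: filterS2 neF neG => d [x Fx] [y Gy].
  by split=> E0; [move: Fx|move: Gy]; rewrite E0.
move=> F0; have G0 := F0; rewrite eqFG // in G0.
move/eventually_nonemptyNP: F0 => F0; move/eventually_nonemptyNP: G0 => G0.
by apply: filterS2 F0 G0 => d -> ->.
Qed.

(** Existence and uniqueness of the Boolean function at once. The clauses for the two values of the
    first variable force [psi] to be [boolval]; the clauses for the other variables then hold by the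
    exchanges that (C) permits. *)
Lemma is_boolfun_atP F p js (psi : boolfun p) : uniq js -> (p + size js)%N = n ->
  is_boolfun_at F js psi <-> psi = boolval (eventually_nonempty F) js.
Proof.
move=> ujs; elim: p js ujs psi => [|p IHp] js ujs psi eqn /=.
  have near_full : eventually_nonempty F js ->
      \forall d \near 0^'+, restr (simplex F) (F d) js = face (simplex F) js.
    move=> /asboolP ne; near=> d; apply: restr_vertex => //.
      by apply: fam_sub.
    by near: d.
  split=> [[[full ->]|[empty ->]]|->]; first last.
  - have [ne|/eventually_nonemptyNP empty] := boolP (eventually_nonempty F js).
      by left; split; [exact: near_full|].
    by right.
  - by have /eventually_nonemptyNP/negPf-> := empty.
  have -> // : eventually_nonempty F js.
  apply/asboolP; apply: filterS full => d ->.
  by apply: face_neq0 => //; move: eqn; lia.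
have le_jn (j : nat) : (j <= p.+1 -> j + size js <= n)%N.
  by move: eqn; lia.
have urcons (j : nat) : (j <= p.+1)%N -> uniq (rcons js (vertex js j)).
  by move=> le_j; rewrite rcons_uniq ujs vertex_notin ?le_jn.
have eqn' (j : nat) : (p + size (rcons js (vertex js j)))%N = n.
  by rewrite size_rcons -addSnnS.
split=> [[fix_false fix_true]|->].
  apply/funext => x; rewrite -[in LHS](insert_var_head_tail x).
  case: (x ord0) => /=.
    have /IHp : is_boolfun_at F (rcons js (vertex js 0)) (fix_var ord0 true psi) by [].
    by move=> /(_ (urcons 0 isT) (eqn' 0)) <-.
  have /IHp := fix_false ord0.
  by move=> /(_ (urcons 1 isT) (eqn' 1)) <-.
split=> [i|]; (apply/IHp; first exact: urcons) => //; apply/funext => x.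
  exact: boolval_insert_false (@eventually_nonempty_swap F) ujs eqn.
exact: boolval_insert_true.
Unshelve. all: end_near. Qed.

Definition boolfun_of F : boolfun n := boolval (eventually_nonempty F) [::].

Lemma is_boolfunP F psi : is_boolfun F psi <-> psi = boolfun_of F.
Proof. by apply: is_boolfun_atP => //; rewrite addn0. Qed.

(** From left to right, [boolval] only evaluates nonemptiness of traces. From right to left,
    equality passes to the functions on all faces, whose values at the origin tell whether the
    traces are nonempty. *)
Lemma comb_equiv_boolfun F G : comb_equiv F G <-> boolfun_of F = boolfun_of G.
Proof.
have swF := @eventually_nonempty_swap F; have swG := @eventually_nonempty_swap G.
split=> [/comb_equivP eqFG|eqFG].
  suff eqp p js : uniq js -> (p + size js)%N = n ->
      boolval (eventually_nonempty F) js =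
      boolval (eventually_nonempty G) js :> boolfun p.
    by apply: (eqp n [::]); rewrite ?addn0.
  elim: p js => [|p IHp] js ujs eqn; apply/funext => x /=; first exact: eqFG.
  have le1 : ((~~ x ord0 : bool) + size js <= n)%N.
    by move: eqn; case: (x ord0) => /=; lia.
  by rewrite IHp // ?size_rcons -?addSnnS // rcons_uniq ujs vertex_notin.
apply/comb_equivP => js ujs; have [sjs|sjs] := leqP (size js) n; last first.
  suff sjs' : size js = n.+1 by rewrite !eventually_nonempty_full.
  apply/eqP; rewrite eqn_leq sjs andbT.
  by rewrite -(card_uniqP ujs) -[X in (_ <= X)%N](card_ord n.+1) max_card.
have eqn := subnK sjs; rewrite -!(boolval_zero _ ujs eqn).
- by apply: boolval_eq_faces => // x; have := congr1 (@^~ x) eqFG.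
- exact: eventually_nonempty_vertex1.
- exact: eventually_nonempty_vertex1.
Qed.

End FamilyBooleanFunction.

(** * The closed simplex *)

Section StaircaseTopology.
Variables (R : realType) (n : nat).
Implicit Types (t p q c : 'rV[R]_n) (js : seq 'I_n.+1) (d e : R).

Lemma bary_continuous (j : 'I_n.+1) : continuous (@bary R n ^~ j).
Proof.
move=> t; case: (unliftP ord0 j) => [i|] ->.
  rewrite (_ : @bary R n ^~ _ = fun t : 'rV[R]_n => t 0 i); first exact: coord_continuous.
  by apply/funext => u; rewrite bary_lift.
rewrite (_ : @bary R n ^~ _ = fun t : 'rV[R]_n => 1 - \sum_i t 0 i); last first.
  by apply/funext => u; rewrite bary0.
have sum_cvg : (fun u : 'rV[R]_n => \sum_i u 0 i) @ t --> \sum_i t 0 i.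
  by apply: cvg_big => [|  |i _]; [exact: add_continuous|exact: nbhs_filter|exact: coord_continuous].
exact: cvgB (cvg_cst _) sum_cvg.
Qed.

Lemma bary_near_lt d p : \forall q \near p, forall u v : 'I_n.+1,
  bary p u < d * bary p v -> bary q u < d * bary q v.
Proof.
suff near_uv u v : \forall q \near p,
    bary p u < d * bary p v -> bary q u < d * bary q v.
  exact: filter_forall _ (fun u => filter_forall _ (near_uv u)).
have [lt_uv|nlt_uv] := pselect (bary p u < d * bary p v); last first.
  by near=> q => /nlt_uv.
have cont : (fun q => d * bary q v - bary q u) q @[q --> p] -->
    d * bary p v - bary p u.
  apply: (@cvgB _ _ _ (nbhs p) _ (fun q => d * bary q v)).
    by apply: cvgMl_tmp; exact: bary_continuous.
  exact: bary_continuous.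
have := @cvgr_gt _ _ _ (nbhs_filter p) _ _ cont 0; rewrite subr_gt0 => /(_ lt_uv).
by apply: (@filterS _ _ (nbhs_filter p)) => q; rewrite subr_gt0.
Unshelve. all: end_near. Qed.

Definition segment p c e : 'rV[R]_n := (1 - e) *: p + e *: c.

Lemma bary_segment p c e j :
  bary (segment p c e) j = (1 - e) * bary p j + e * bary c j.
Proof.
case: (unliftP ord0 j) => [i|] ->; first by rewrite !bary_lift !mxE.
rewrite !bary0; under eq_bigr do rewrite !mxE.
by rewrite big_split /= -!mulr_sumr; ring.
Qed.

(** Membership in a closure will be shown by moving the point slightly toward a well-chosen [c]. *)
Lemma closure_segment (A : set 'rV[R]_n) p c :
  (\forall e \near 0^'+, A (segment p c e)) -> closure A p.
Proof.
move=> nearA B pB.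
have segp : segment p c e @[e --> 0^'+] --> p.
  apply: cvg_at_right_filter.
  have cvgp : (fun e : R => (1 - e) *: p) @ (0 : R) --> (1 - 0) *: p.
    by apply: cvgZr_tmp; exact: cvgB (cvg_cst _) cvg_id.
  have cvgc : (fun e : R => e *: c) @ (0 : R) --> 0 *: c.
    by apply: cvgZr_tmp; exact: cvg_id.
  by have := cvgD cvgp cvgc; rewrite subr0 scale1r scale0r addr0; exact.
near (0:R)^'+ => e; exists (segment p c e); split; near: e => //.
exact: segp.
Unshelve. all: end_near. Qed.

Definition closed_simplex : set 'rV[R]_n := [set t | forall j, 0 <= bary t j].

Lemma closed_simplex_closed : closed closed_simplex.
Proof.
move=> p clp j; rewrite leNgt; apply/negP => pj.
have [q [Kq]] := clp _ (cvgr_lt _ (@bary_continuous j p) _ pj).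
by rewrite ltNge Kq.
Qed.

Lemma closure_std_simplex : closure (@std_simplex R n) = closed_simplex.
Proof.
rewrite -std_simplexE; apply/seteqP; split.
  rewrite closureE; apply: smallest_sub closed_simplex_closed _ => t ft j.
  exact: bary_ge0 ft.
move=> p Kp; have [c fc] := @std_face_neq0 R n [::] isT isT.
apply: (closure_segment (c := c)); near=> e.
have e0 : 0 < e by [].
have e1 : e < 1 by near: e; exact: nbhs_right_lt.
move=> j; rewrite in_nil bary_segment ltr_wpDl //.
  by rewrite mulr_ge0 // subr_ge0 ltW.
by rewrite mulr_gt0 // (bary_notin fc).
Unshelve. all: end_near. Qed.

Lemma closed_simplex_compact : compact closed_simplex.
Proof.
have box : compact [set t : 'rV[R]_n | forall i, `[0, 1]%classic (t ord0 i)].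
  by apply: (@rV_compact R n (fun=> `[0, 1]%classic)) => i; exact: segment_compact.
apply: subclosed_compact closed_simplex_closed box _ => t Kt i /=.
rewrite in_itv /= -bary_lift Kt -(sum_bary t) (bigD1 (lift ord0 i)) //=.
by rewrite lerDl sumr_ge0.
Qed.

End StaircaseTopology.

(** * The family with a given Boolean function *)

Section Patterns.
Variable n : nat.
Implicit Types (js : seq 'I_n.+1) (b : 'I_n.+1 -> bool) (psi : boolfun n).

(* Vertex i > 0 stands for the variable x_i. *)
Definition bits b : {ffun 'I_n -> bool} := [ffun i => b (lift ord0 i)].

Definition antitone psi := forall x y : {ffun 'I_n -> bool},
  (forall i, x i -> y i) -> psi y -> psi x.

Lemma antitone_bits psi b b' : antitone psi ->
  (forall v, b v -> b' v) -> psi (bits b') -> psi (bits b).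
Proof. by move=> anti bb'; apply: anti => i; rewrite !ffunE; apply: bb'. Qed.

(** At the most significant index where x and y differ, x has 0 and y has 1, so x precedes y
    lexicographically. *)
Lemma lex_monotone_antitone psi : lex_monotone psi -> antitone psi.
Proof.
move=> lexpsi x y xy; have [->//|neq] := eqVneq x y.
have [i0 neqi0] : exists i, x i != y i.
  apply/existsP; apply: contraNT neq; rewrite negb_exists => /forallP eqxy.
  by apply/eqP/ffunP => i; apply/eqP; rewrite -[_ == _]negbK.
case: (@arg_maxnP _ i0 (fun i => x i != y i) val neqi0) => i neqi maxi.
apply: lexpsi; exists i; split.
- by case: (x i) neqi (xy i) => // + /(_ isT); case: (y i).
- by case: (x i) neqi (xy i) => [+ /(_ isT)|]; case: (y i).
- move=> k ltik; apply/eqP; apply: contraTT ltik => /maxi.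
  by rewrite -leqNgt.
Qed.

(* The value taken by the variable x_v once v has been removed in the course of
   js, or once v has become the lowest remaining vertex. *)
Definition pattern js (v : 'I_n.+1) :=
  [forall u : 'I_n.+1, (u < v)%N ==> (u \in take (index v js) js)].

(** For v outside [js], [index v js] is the length of [js], so that all of [js] counts. *)
Lemma patternP js v : v \notin js ->
  reflect (forall u : 'I_n.+1, (u < v)%N -> u \in js) (pattern js v).
Proof.
move=> vjs; rewrite /pattern memNindex // take_size.
by apply: (iffP forallP) => H u; apply/implyP/H.
Qed.

(** The value of x_v is frozen when v is removed: only earlier removals count, also when v is the
    last vertex removed. *)
Lemma pattern_rcons js k v : v \in rcons js k ->
  pattern (rcons js k) v = pattern js v.
Proof.
rewrite mem_rcons inE /pattern -cats1 index_cat => vjk; apply: eq_forallb => u.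
congr (_ ==> (u \in _)); case: (boolP (v \in js)) vjk => [vjs _|vjs].
  by rewrite take_cat index_mem vjs.
rewrite orbF => /eqP<-; rewrite /= eqxx addn0 take_cat ltnn subnn take0 cats0.
by rewrite memNindex ?take_size.
Qed.

(** Only the removal of the lowest remaining vertex can make another vertex the lowest. This yields
    (A) for the constructed family. *)
Lemma pattern_rcons_vertex js j v : uniq js -> (0 < j)%N ->
  (j + size js <= n)%N ->
  pattern (rcons js (vertex js j)) v = pattern js v.
Proof.
move=> ujs j0 le_jn; have [|vjk] := boolP (v \in rcons js (vertex js j)).
  exact: pattern_rcons.
have vjs : v \notin js.
  by apply: contra vjk; rewrite mem_rcons inE orbC => ->.
apply/(patternP vjk)/(patternP vjs) => H u ltuv; last first.
  by rewrite mem_rcons inE H ?orbT.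
have v0js : vertex js 0 \notin js.
  by rewrite vertex_notin // (leq_trans _ le_jn) // leq_add2r.
have lt0j := vertex_lt ujs j0 le_jn.
have := H u ltuv; rewrite mem_rcons inE => /predU1P[ujE|//].
have := H (vertex js 0); rewrite mem_rcons inE (negPf v0js) orbF.
have lt0v : (vertex js 0 < v)%N by rewrite (ltn_trans lt0j) // -ujE.
by move=> /(_ lt0v)/eqP E; move: lt0j; rewrite {1}E ltnn.
Qed.

(** Call a < b the two vertices. The value at a ignores the higher vertex b. The value at b is 0 in
    both orders, because a third remaining vertex lies below b; this fails exactly for the pair (0,
    1). Elsewhere the order is irrelevant. *)
Lemma pattern_swap js l k v : uniq js -> (l < k)%N -> (k + size js <= n)%N ->
    (l, k) != (0%N, 1%N) ->
  pattern (js ++ [:: vertex js l; vertex js k]) v =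
  pattern (js ++ [:: vertex js k; vertex js l]) v.
Proof.
move=> ujs lt_lk le_kn neq.
have le_ln : (l + size js <= n)%N by rewrite (leq_trans _ le_kn) // leq_add2r ltnW.
have ljs := vertex_notin ujs le_ln; have kjs := vertex_notin ujs le_kn.
have lt_v := vertex_lt ujs lt_lk le_kn.
pose rc js k := rcons js k.
have -> : js ++ [:: vertex js l; vertex js k] = rc (rc js (vertex js l)) (vertex js k).
  by rewrite /rc -!cats1 -catA.
have -> : js ++ [:: vertex js k; vertex js l] = rc (rc js (vertex js k)) (vertex js l).
  by rewrite /rc -!cats1 -catA.
rewrite /rc; set a := vertex js l in ljs lt_v *; set b := vertex js k in kjs lt_v *.
have neq_ab : a != b by apply: contraTneq lt_v => ->; rewrite ltnn.
have [vab|vab] := boolP (v \in rcons (rcons js a) b); last first.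
  have vba : v \notin rcons (rcons js b) a.
    by apply: contra vab; rewrite !mem_rcons !inE !mem_rcons !inE orbCA.
  by apply/(patternP vab)/(patternP vba) => H u /H;
    rewrite !mem_rcons !inE !mem_rcons !inE orbCA.
have vba : v \in rcons (rcons js b) a.
  by move: vab; rewrite !mem_rcons !inE !mem_rcons !inE orbCA.
rewrite [LHS]pattern_rcons // [RHS]pattern_rcons //.
have [va|nva] := eqVneq v a.
  rewrite va pattern_rcons ?mem_rcons ?mem_head //.
  have ajb : a \notin rcons js b by rewrite mem_rcons inE negb_or neq_ab.
  apply/(patternP ljs)/(patternP ajb) => H u ltua; first by rewrite mem_rcons inE H ?orbT.
  have := H u ltua; rewrite mem_rcons inE => /predU1P[ub|//].
  by move: ltua; rewrite ub ltnNge ltnW.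
have [vb|nvb] := eqVneq v b; last first.
  have vjs : v \in js.
    by move: vab; rewrite !mem_rcons !inE !mem_rcons !inE (negPf nva) (negPf nvb).
  by rewrite !pattern_rcons ?mem_rcons ?inE ?vjs ?orbT.
rewrite vb [RHS]pattern_rcons ?mem_rcons ?mem_head //.
have bja : b \notin rcons js a by rewrite mem_rcons inE negb_or eq_sym neq_ab.
(* The third vertex has label 1 if l = 0, since then k > 1, and label 0 otherwise. *)
have [i lt_ik neq_il] : exists2 i, (i < k)%N & i != l.
  case: l lt_lk neq {le_ln ljs lt_v a neq_ab vab vba nva bja} => [|l] lt_lk neq.
    by exists 1%N => //; case: k lt_lk neq {le_kn kjs b vb} => [|[|k]].
  by exists 0%N => //; apply: leq_trans lt_lk.
have le_in : (i + size js <= n)%N by rewrite (leq_trans _ le_kn) // leq_add2r ltnW.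
have ijs := vertex_notin ujs le_in.
have lt_ib : (vertex js i < b)%N by exact: vertex_lt.
transitivity false; last first.
  by apply/esym/negbTE/negP => /(patternP kjs)/(_ _ lt_ib); rewrite (negPf ijs).
apply/negbTE/negP => /(patternP bja)/(_ _ lt_ib); rewrite mem_rcons inE (negPf ijs) orbF.
have [lt_il|lt_li|eq_il] := ltngtP i l; last by rewrite eq_il eqxx in neq_il.
  by have := vertex_lt ujs lt_il le_ln; rewrite -/a => + /eqP E; rewrite E ltnn.
by have := vertex_lt ujs lt_li le_in; rewrite -/a => + /eqP E; rewrite E ltnn.
Qed.

(* While the variables are read from y one by one, m is the lowest remaining
   vertex and the other vertices up to size js have been removed. *)
Lemma boolval_pattern psi (y : {ffun 'I_n -> bool})
    (E : seq 'I_n.+1 -> bool) p js (m : 'I_n.+1) (x : {ffun 'I_p -> bool}) :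
    (forall js, uniq js -> size js = n -> E js = psi (bits (pattern js))) ->
    uniq js -> (p + size js)%N = n ->
    (m <= size js)%N ->
    (forall v : 'I_n.+1, (v \in js) = (v <= size js)%N && (v != m)) ->
    (forall i : 'I_n, (i < size js)%N -> pattern js (lift ord0 i) = y i) ->
    (forall (i : 'I_n) (j : 'I_p), i = (size js + j)%N :> nat -> x j = y i) ->
  boolval E js x = psi y.
Proof.
move=> Epsi; elim: p js m x => [|p IHp] js m x ujs eqn le_m memjs pat xy /=.
  rewrite Epsi //; congr psi; apply/ffunP => i; rewrite ffunE pat //.
  by move: eqn; rewrite add0n => ->.
have le1 : (1 + size js <= n)%N by move: eqn; lia.
have v0E : vertex js 0 = m.
  apply/val_inj/eqP; rewrite /= eqn_leq vertex0_le ?memjs ?eqxx ?andbF //=.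
  have := vertex_notin ujs (ltnW le1 : 0 + size js <= n)%N.
  rewrite memjs negb_and negbK -ltnNge => /orP[lt0|/eqP->//].
  exact: leq_trans le_m (ltnW lt0).
have lts : ((size js).+1 < n.+1)%N by [].
(* The second lowest remaining vertex; its variable is the next one read from [y]. *)
pose s : 'I_n.+1 := Ordinal lts.
have sjs : s \notin js by rewrite memjs /= ltnn.
have v1E : vertex js 1 = s.
  have [[|[|i]] le_in sE] := vertex_onto ujs sjs; last 1 first.
  - have := vertex_lt ujs (isT : 1 < i.+2)%N le_in; rewrite -sE /= ltnS => le1s.
    have := vertex_notin ujs le1; rewrite memjs le1s /= negbK -v0E => /eqP v10.
    by have := vertex_lt ujs (isT : 0 < 1)%N le1; rewrite v10 ltnn.
  - by move: le_m; rewrite -v0E -sE /= ltnn.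
  - by [].
pose i : 'I_n := Ordinal (le1 : size js < n)%N.
have sE : lift ord0 i = s by apply: val_inj.
have xi : x ord0 = y i by apply: xy; rewrite /= addn0.
have tailE : forall (i : 'I_n) (j : 'I_p), i = ((size js).+1 + j)%N :> nat ->
    tail_var x j = y i.
  by move=> i' j ij; rewrite ffunE; apply: xy; rewrite ij /= /bump addSnnS.
have mjs : m \notin js by rewrite memjs eqxx andbF.
have lt_ms : (m < s)%N by [].
have below_m : pattern js m.
  by apply/(patternP mjs) => u ltum; rewrite memjs neq_ltn ltum ltnW // (leq_trans ltum).
(* Variables already read keep their values: their vertex is either removed, hence frozen, or equal
   to m, whose value is 1 and stays 1. *)
have pat_lt k (i' : 'I_n) : k = m \/ k = s -> (i' < size js)%N ->
    pattern (rcons js k) (lift ord0 i') = y i'.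
  move=> kE lti; have [vjs|] := boolP (lift ord0 i' \in js).
    by rewrite pattern_rcons ?pat // mem_rcons inE vjs orbT.
  rewrite memjs lift0 lti /= negbK => /eqP vm; rewrite -pat // vm.
  case: kE => ->; first by rewrite pattern_rcons // mem_rcons mem_head.
  rewrite below_m; have msjs : m \notin rcons js s.
    by rewrite mem_rcons inE negb_or mjs neq_ltn lt_ms.
  apply/(patternP msjs) => u ltum; rewrite mem_rcons inE.
  by move/(patternP mjs)/(_ _ ltum): below_m => ->; rewrite orbT.
have iE (i' : 'I_n) : (size js <= i')%N -> (i' < (size js).+1)%N -> i' = i.
  by move=> ge_i lt_i; apply/val_inj/eqP; rewrite /= eqn_leq ge_i andbT -ltnS.
(* If the value read is 1, m is removed and s becomes the lowest vertex, with value 1. If it is 0, s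
   is removed while m remains below it, and its value is frozen at 0. *)
case: (x ord0) xi => /= xi.
  apply: (IHp _ s) => //; rewrite ?size_rcons ?v0E //.
  - by rewrite rcons_uniq mjs.
  - by move: eqn; lia.
  - move=> v; rewrite mem_rcons inE memjs -[v == s](inj_eq val_inj) /=.
    have [->|_] := eqVneq v m; first by rewrite leqW // ltn_eqF.
    by rewrite /= andbT [RHS]andbC -ltn_neqAle.
  - move=> i' lti; have [/(pat_lt m)->//|ge_i] := ltnP i' (size js).
      by left.
    rewrite (iE _ ge_i lti) sE -xi; have smjs : s \notin rcons js m.
      by rewrite mem_rcons inE negb_or sjs neq_ltn lt_ms orbT.
    apply/(patternP smjs) => u /= ltu; rewrite mem_rcons inE memjs.
    by have [//|_] := eqVneq u m; rewrite andbT -ltnS.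
apply: (IHp _ m) => //; rewrite ?size_rcons ?v1E //.
- by rewrite rcons_uniq sjs.
- by move: eqn; lia.
- exact: leqW.
- move=> v; rewrite mem_rcons inE memjs -[v == s](inj_eq val_inj) /=.
  rewrite [(v <= _.+1)%N]leq_eqVlt ltnS; case: (eqVneq (v : nat) _) => //= vs.
  by rewrite -(inj_eq val_inj) /= vs gtn_eqF.
- move=> i' lti; have [/(pat_lt s)->//|ge_i] := ltnP i' (size js).
    by right.
  rewrite (iE _ ge_i lti) sE -xi pattern_rcons ?mem_rcons ?mem_head //.
  by apply/negbTE/negP => /(patternP sjs)/(_ _ lt_ms); rewrite (negPf mjs).
Qed.

End Patterns.

(** * The sets defined by psi, and their traces *)

Section Staircase.
Variables (R : realType) (n : nat) (psi : boolfun n).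
Hypothesis anti : antitone psi.
Implicit Types (t p q c : 'rV[R]_n) (js : seq 'I_n.+1) (d e : R).

(** The value of x_v at a point of the face opposite to [js]. For a remaining v, the inequalities
    with removed u hold automatically on the face, their left side being 0. *)
Definition status js d t (v : 'I_n.+1) :=
  if v \in js then pattern js v
  else [forall u : 'I_n.+1, (u < v)%N ==> (bary t u < d * bary t v)].

Definition staircase js d : set 'rV[R]_n :=
  [set t | std_face js t /\ psi (bits (status js d t))].

Lemma statusP js d t v : v \notin js ->
  reflect (forall u : 'I_n.+1, (u < v)%N -> bary t u < d * bary t v)
          (status js d t v).
Proof.
move=> vjs; rewrite /status (negPf vjs).
by apply: (iffP forallP) => H u; apply/implyP/H.
Qed.

Lemma status_in js d t v : v \in js -> status js d t v = pattern js v.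
Proof. by rewrite /status => ->. Qed.

(** So the pattern is the least assignment occurring on the face, and the one where the antitone psi
    is largest. *)
Lemma pattern_status js d t v : 0 < d -> std_face js t ->
  pattern js v -> status js d t v.
Proof.
move=> d0 ft; have [vjs|vjs] := boolP (v \in js); first by rewrite status_in.
move=> /(patternP vjs) H; apply/(statusP _ _ vjs) => u /H ujs.
by rewrite (bary_in ft ujs) mulr_gt0 // (bary_notin ft).
Qed.

(** The strict inequalities are open, so variables can only gain ones near p. As psi is antitone,
    its truth then passes to limits. *)
Lemma status_near js d p : \forall q \near p, forall v,
  status js d p v -> status js d q v.
Proof.
apply: (@filterS _ _ (nbhs_filter p)) (bary_near_lt d p) => q near_q v.
have [vjs|vjs] := boolP (v \in js); first by rewrite !status_in.
by move=> /(statusP _ _ vjs) H; apply/(statusP _ _ vjs) => u /H/near_q.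
Qed.

(** For the inclusion from left to right, points of the staircase near p have at least the ones of
    p. For the converse, p is moved slightly toward vertex k without creating new ones: x_k is 0
    there if a vertex below k remains, which agrees with the pattern, and the other variables can
    only lose ones. *)
Lemma closure_staircase js k d : 0 < d -> k \notin js ->
  closure (staircase js d) `&` std_face (rcons js k) = staircase (rcons js k) d.
Proof.
move=> d0 kjs; apply/seteqP; split=> p [].
  move=> clp fp; split=> //.
  have [q [[fq psiq] /= near_q]] := clp _ (status_near js d p).
  apply: antitone_bits psiq => // v; have [vjk|vjk] := boolP (v \in rcons js k).
    rewrite status_in // pattern_rcons //; exact: pattern_status.
  have vjs : v \notin js by apply: contra vjk; rewrite mem_rcons inE orbC => ->.
  move=> /(statusP _ _ vjk) H; apply: near_q; exact/(statusP _ _ vjs).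
move=> fp psip; split=> //.
(* The vertex k itself, so that k gets the coordinate e and all others are scaled by 1 - e. *)
pose c := bary_point (fun j => (j == k)%:R : R).
have cE : bary c =1 (fun j => (j == k)%:R).
  apply: bary_pointK; rewrite (bigD1 k) //= eqxx big1 ?addr0 // => j.
  by move=> /negPf->.
have pk : bary p k = 0 by rewrite (bary_in fp) // mem_rcons mem_head.
apply: (closure_segment (c := c)).
have [b b0 Hb] : exists2 b : R, 0 < b & forall e, 0 < e -> e < b -> e < 1 ->
    status js d (segment p c e) k -> pattern js k.
  have [[u [ltuk ujs]]|all_js] := pselect (exists u : 'I_n.+1,
      (u < k)%N /\ u \notin js); last first.
    exists 1 => // e _ _ _ _; apply/(patternP kjs) => u ltuk.
    by apply: contrapT => /negP ujs; apply: all_js; exists u.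
  have uk : u != k by apply: contraTneq ltuk => ->; rewrite ltnn.
  have pu : 0 < bary p u.
    by rewrite (bary_notin fp) // mem_rcons inE negb_or uk.
  (* Below this bound d e < (1 - e) p_u, where p_u is the coordinate of u, which contradicts x_k =
     1. *)
  exists (bary p u / (bary p u + d)); first by rewrite divr_gt0 // addr_gt0.
  move=> e e0; rewrite ltr_pdivlMr ?addr_gt0 // => lte _.
  move=> /(statusP _ _ kjs)/(_ _ ltuk).
  rewrite !bary_segment !cE pk (negPf uk) eqxx !mulr0 addr0 add0r mulr1 => lt_u.
  suff: False by []; lra.
near=> e.
have e0 : 0 < e by [].
have e1 : e < 1 by near: e; exact: nbhs_right_lt.
have eb : e < b by near: e; exact: nbhs_right_lt.
have segE j : j != k -> bary (segment p c e) j = (1 - e) * bary p j.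
  by move=> /negPf jk; rewrite bary_segment cE jk mulr0 addr0.
split.
  move=> j; have [->|jk] := eqVneq j k.
    by rewrite (negPf kjs) bary_segment cE pk eqxx mulr0 add0r mulr1.
  rewrite segE //; have := fp j; rewrite mem_rcons inE (negPf jk) /=.
  by case: ifP => _ => [->|pj]; rewrite ?mulr0 // mulr_gt0 // subr_gt0.
apply: antitone_bits psip => // v.
have [vjs|vjs] := boolP (v \in js).
  by rewrite !status_in ?pattern_rcons // mem_rcons inE vjs orbT.
have [->|vk] := eqVneq v k.
  by move=> /Hb; rewrite status_in ?pattern_rcons ?mem_rcons ?mem_head //; exact.
have vjk : v \notin rcons js k by rewrite mem_rcons inE negb_or vk.
move=> /(statusP _ _ vjs) H; apply/(statusP _ _ vjk) => u ltuv.
(* After scaling by 1 - e, the inequality on the segment implies the one at p, since the coordinate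
   of u on the segment is at least (1 - e) times that at p, also for u = k. *)
rewrite -(ltr_pM2l (_ : 0 < 1 - e)) ?subr_gt0 // mulrCA -(segE v vk).
apply: le_lt_trans (H u ltuv); rewrite bary_segment cE lerDl.
by rewrite mulr_ge0 // ltW.
Unshelve. all: end_near. Qed.

(** For the converse the barycentre of the face serves: all remaining coordinates are equal, so for
    d <= 1 no inequality between two of them holds, and only the ones of the pattern are left. *)
Lemma staircase_nonempty js d : uniq js -> (size js <= n)%N -> 0 < d -> d <= 1 ->
  staircase js d !=set0 <-> psi (bits (pattern js)).
Proof.
move=> ujs sjs d0 d1; split=> [[t [ft psit]]|psiZ].
  by apply: antitone_bits psit => // v; exact: pattern_status.
have vjs := vertex_notin (i := 0) ujs sjs.
have [//|c c0 [t ft tE]] := @std_face_weights R n js (fun=> 1) _ vjs.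
exists t; split=> //; apply: antitone_bits psiZ => // v.
have [vjs'|{}vjs] := boolP (v \in js); first by rewrite status_in.
move=> /(statusP _ _ vjs) H; apply/(patternP vjs) => u ltuv.
apply: contrapT => /negP ujs'; have := H u ltuv.
by rewrite !tE // mulr1 ltNge ler_piMl // ltW.
Qed.

(* On the facet opposite to the lowest remaining vertex some point has all its
   remaining variables equal to 1; by antitonicity psi is then 1 everywhere. *)
Lemma staircase_full js d : uniq js -> (size js < n)%N -> 0 < d ->
  staircase (rcons js (vertex js 0)) d = std_face (rcons js (vertex js 0)) ->
  staircase js d = std_face js.
Proof.
move=> ujs sjs d0; set k := vertex js 0 => full.
have kjs : k \notin js by rewrite vertex_notin // ltnW.
have ukjs : uniq (rcons js k) by rewrite rcons_uniq kjs.
have vjk : vertex (rcons js k) 0 \notin rcons js k.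
  by rewrite vertex_notin // size_rcons.
(* Geometric weights: for u < v, d times the weight of v is at least 1 + d times the weight of u,
   hence larger than it. *)
pose w (v : 'I_n.+1) : R := (d^-1 + 1) ^+ v.
have d1 : 1 < d^-1 + 1 by rewrite ltrDr invr_gt0.
have w0 v : 0 < w v by rewrite exprn_gt0 // (lt_trans ltr01).
have [//|c c0 [t ft tE]] := @std_face_weights R n (rcons js k) w _ vjk.
have [_ psit] : staircase (rcons js k) d t by rewrite full.
apply/seteqP; split=> [p []//|p fp]; split=> //.
apply: antitone_bits psit => // v.
have [vjs|vjs] := boolP (v \in js).
  by rewrite !status_in ?pattern_rcons // mem_rcons inE vjs orbT.
move=> _; have [->|vk] := eqVneq v k.
  rewrite status_in ?mem_rcons ?mem_head // pattern_rcons ?mem_rcons ?mem_head //.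
  apply/(patternP kjs) => u; apply: contraTT => ujs'.
  by rewrite -leqNgt vertex0_le.
have {}vjk : v \notin rcons js k by rewrite mem_rcons inE negb_or vk.
apply/(statusP _ _ vjk) => u ltuv; rewrite [X in _ < d * X]tE //.
have [ujk|ujk] := boolP (u \in rcons js k).
  by rewrite (bary_in ft ujk) mulr_gt0 // mulr_gt0.
rewrite tE // mulrCA ltr_pM2l //.
have le_w : w u * (d^-1 + 1) <= w v.
  by rewrite -exprSr ler_weXn2l // ltW.
have : d * (w u * (d^-1 + 1)) <= d * w v by rewrite ler_pM2l.
apply: lt_le_trans; rewrite mulrCA mulrDr mulfV ?gt_eqF // mulr1 mulrDr mulr1.
by rewrite ltrDl mulr_gt0.
Qed.

Lemma staircase_swap js l k d : uniq js -> (l < k)%N -> (k + size js <= n)%N ->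
    (l, k) != (0%N, 1%N) ->
  staircase (js ++ [:: vertex js l; vertex js k]) d =
  staircase (js ++ [:: vertex js k; vertex js l]) d.
Proof.
move=> ujs lt_lk le_kn neq.
have eqj : js ++ [:: vertex js l; vertex js k] =i js ++ [:: vertex js k; vertex js l].
  by move=> v; rewrite !mem_cat !inE [(_ == _) || _]orbC.
have statusE t : status (js ++ [:: vertex js l; vertex js k]) d t =
    status (js ++ [:: vertex js k; vertex js l]) d t.
  by apply/funext => v; rewrite /status eqj pattern_swap.
by apply/seteqP; split=> t; rewrite /staircase /= (eq_std_face _ eqj) statusE.
Qed.

(** Take d below all remaining coordinates of t, hence also of the points q near t. As coordinates
    are at most 1, no inequality between two remaining vertices holds at q, so every variable is
    bounded by its pattern value. *)
Lemma staircase_interior js e : psi (bits (pattern js)) -> 0 < e ->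
  \bigcup_(d in `]0, e[) relative_interior (std_face js) (staircase js d) =
  std_face js.
Proof.
move=> psiZ e0; apply/seteqP; split=> [t [d _ []]//|t ft].
have near_d : \forall d \near 0^'+, forall v, v \notin js -> d < bary t v.
  apply: filter_forall => v; have [vjs|vjs] := boolP (v \in js).
    exact: nearW.
  by near=> d => _; near: d; apply: nbhs_right_lt; exact: bary_notin ft vjs.
near (0:R)^'+ => d.
have d0 : 0 < d by [].
have de : d < e by near: d; exact: nbhs_right_lt.
have dt : forall v, v \notin js -> d < bary t v by near: d.
exists d; first by rewrite /= in_itv /= d0.
split=> //.
have near_q : \forall q \near t, forall v, v \notin js -> d < bary q v.
  suff near_v v : \forall q \near t, v \notin js -> d < bary q v.
    exact: filter_forall _ near_v.
  have [vjs|vjs] := boolP (v \in js); first by near=> q.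
  apply: (@filterS _ _ (nbhs_filter t)); last first.
    exact: (@cvgr_gt _ _ _ (nbhs_filter t) _ _ (@bary_continuous R n v t) d (dt v vjs)).
  by [].
apply: (@filterS _ _ (nbhs_filter t)) near_q => q dq fq; split=> //.
apply: antitone_bits psiZ => // v.
have [vjs|vjs] := boolP (v \in js); first by rewrite status_in.
move=> /(statusP _ _ vjs) H; apply/(patternP vjs) => u ltuv.
apply: contrapT => /negP ujs; have := H u ltuv.
rewrite ltNge => /negP; apply; apply: le_trans (ltW (dq u ujs)).
rewrite ler_piMr ?(ltW d0) //.
rewrite -(sum_bary q) (bigD1 v) //= lerDl sumr_ge0 // => j _.
exact: bary_ge0 fq.
Unshelve. all: end_near. Qed.

End Staircase.

(** * Semialgebraic sets are definable *)

Section Definability.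
Variables (R : realType) (O : o_minimal_structure R).

Definition polynomial_fun n (f : 'rV[R]_n -> R) :=
  exists p : mpoly.mpoly n R, forall x, f x = mpoly.meval (x ord0) p.

Lemma polynomial_fun_cst n (a : R) : polynomial_fun (fun _ : 'rV[R]_n => a).
Proof. by exists (mpoly.mpolyC n a) => x; rewrite mpoly.mevalC. Qed.

Lemma polynomial_fun_coord n (i : 'I_n) :
  polynomial_fun (fun x : 'rV[R]_n => x 0 i).
Proof. by exists (mpoly.mpolyX R (mpoly.mnm1 i)) => x; rewrite mpoly.mevalXU. Qed.

Lemma polynomial_funD n (f g : 'rV[R]_n -> R) :
  polynomial_fun f -> polynomial_fun g -> polynomial_fun (fun x => f x + g x).
Proof.
by move=> [p fE] [q gE]; exists (p + q) => x; rewrite mpoly.mevalD fE gE.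
Qed.

Lemma polynomial_funM n (f g : 'rV[R]_n -> R) :
  polynomial_fun f -> polynomial_fun g -> polynomial_fun (fun x => f x * g x).
Proof.
by move=> [p fE] [q gE]; exists (p * q) => x; rewrite mpoly.mevalM fE gE.
Qed.

Lemma polynomial_funB n (f g : 'rV[R]_n -> R) :
  polynomial_fun f -> polynomial_fun g -> polynomial_fun (fun x => f x - g x).
Proof.
by move=> [p fE] [q gE]; exists (p - q) => x; rewrite mpoly.mevalB fE gE.
Qed.

Lemma polynomial_fun_sum n I (r : seq I) (f : I -> 'rV[R]_n -> R) :
  (forall i, polynomial_fun (f i)) ->
  polynomial_fun (fun x => \sum_(i <- r) f i x).
Proof.
move=> pf; elim: r => [|i r [p pE]].
  by have [p pE] := polynomial_fun_cst n 0; exists p => x; rewrite big_nil.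
have [q qE] := polynomial_funD (pf i) (ex_intro _ p pE).
by exists q => x; rewrite big_cons qE.
Qed.

Lemma polynomial_fun_lsubmx n k (f : 'rV[R]_n -> R) :
  polynomial_fun f -> polynomial_fun (fun z : 'rV[R]_(n + k) => f (lsubmx z)).
Proof.
move=> [p fE]; pose X (i : 'I_n) := mpoly.mpolyX R (mpoly.mnm1 (lshift k i)).
exists (mpoly.comp_mpoly (mktuple X) p) => z.
rewrite fE mpoly.comp_mpoly_meval; congr (mpoly.meval _ p).
by apply/funext => i; rewrite tnth_mktuple mpoly.mevalXU mxE.
Qed.

Lemma polynomial_fun_bary n (j : 'I_n.+1) : polynomial_fun (@bary R n ^~ j).
Proof.
case: (unliftP ord0 j) => [i|] ->.
  have [p pE] := polynomial_fun_coord i.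
  by exists p => t; rewrite bary_lift pE.
have [p pE] := polynomial_funB (polynomial_fun_cst n 1)
  (polynomial_fun_sum (index_enum 'I_n) (@polynomial_fun_coord n)).
by exists p => t; rewrite bary0 pE.
Qed.

Lemma definable_eq0 n (f : 'rV[R]_n -> R) :
  polynomial_fun f -> definable O [set x | f x = 0].
Proof.
move=> [p fE]; have := definable_algebraic O p; congr (definable O).
by apply/seteqP; split=> x /=; rewrite fE.
Qed.

Lemma definableT n : definable O [set: 'rV[R]_n].
Proof.
have := definable_eq0 (polynomial_fun_cst n 0); congr (definable O).
by apply/seteqP; split.
Qed.

Lemma definable_setI n (A B : set 'rV[R]_n) :
  definable O A -> definable O B -> definable O (A `&` B).
Proof.
move=> dA dB; rewrite -[_ `&` _]setCK setCI.
by apply: definable_setC; apply: definable_setU; apply: definable_setC.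
Qed.

Lemma definable_forall n (I : finType) (A : I -> set 'rV[R]_n) :
  (forall i, definable O (A i)) -> definable O [set x | forall i, A i x].
Proof.
move=> dA.
suff dr (r : seq I) : definable O [set x | forall i, i \in r -> A i x].
  have := dr (enum I); congr (definable O).
  by apply/seteqP; split=> x Ax i => [|_]; apply: Ax; rewrite mem_enum.
elim: r => [|i r IHr].
  by have := definableT n; congr (definable O); apply/seteqP; split.
have := definable_setI (dA i) IHr; congr (definable O).
apply/seteqP; split=> x /= => [[Aix Arx] j|Ax].
  by rewrite inE => /predU1P[->|/Arx].
split; first by apply: Ax; rewrite mem_head.
by move=> j jr; apply: Ax; rewrite inE jr orbT.
Qed.

Lemma definable_exists n (I : finType) (A : I -> set 'rV[R]_n) :
  (forall i, definable O (A i)) -> definable O [set x | exists i, A i x].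
Proof.
move=> dA; have := definable_forall (fun i => definable_setC (dA i)).
move/definable_setC; congr (definable O); apply/seteqP; split=> x /=.
  by move=> nall; apply: contrapT => nex; apply: nall => i Aix; apply: nex; exists i.
by move=> [i Aix] /(_ i).
Qed.

Lemma definable_prop n (P : Prop) : definable O [set _ : 'rV[R]_n | P].
Proof.
have [p|np] := pselect P.
  by have := definableT n; congr (definable O); apply/seteqP; split.
have := definable_setC (definableT n); congr (definable O).
by apply/seteqP; split=> // x /=.
Qed.

(** A finite union over the assignments y with phi y = 1. *)
Lemma definable_boolfun n (I : finType) (phi : {ffun I -> bool} -> bool)
    (B : 'rV[R]_n -> I -> bool) :
  (forall i, definable O [set x | B x i]) ->
  definable O [set x | phi [ffun i => B x i]].
Proof.
move=> dB; have : definable O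
    [set x | exists y : {ffun I -> bool}, phi y /\ forall i, B x i = y i].
  apply: definable_exists => y.
  apply: definable_setI; first exact: definable_prop.
  apply: definable_forall => i; case: (y i); first exact: dB.
  have := definable_setC (dB i); congr (definable O).
  by apply/seteqP; split=> x /=; [move/negP/negbTE|move=> ->].
congr (definable O); apply/seteqP; split=> x /= => [[y [phiy By]]|phiB].
  by rewrite (_ : [ffun i => B x i] = y) //; apply/ffunP => i; rewrite ffunE.
by exists [ffun i => B x i]; split=> // i; rewrite ffunE.
Qed.

(** The axioms give equations in all dimensions but inequalities only on the line. The set is the
    projection of the part of the graph of f over which the last coordinate is positive. *)
Lemma definable_gt0 n (f : 'rV[R]_n -> R) :
  polynomial_fun f -> definable O [set x | 0 < f x].
Proof.
move=> pf; have pos : definable O [set y : 'rV[R]_1 | 0 < y 0 0].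
  apply/definable1P; exists [:: `]0, +oo[] => y /=.
  by rewrite orbF in_itv /= andbT.
have graph : definable O [set z : 'rV[R]_(n + 1) |
    f (lsubmx z) - z 0 (rshift n 0) = 0].
  apply: definable_eq0; apply: polynomial_funB (polynomial_fun_coord _).
  exact: polynomial_fun_lsubmx.
have := definable_proj (definable_setI graph (definable_setX (definableT n) pos)).
congr (definable O); apply/seteqP; split=> x /=.
  by move=> [z [/eqP + [_ z0]] <-]; rewrite subr_eq0 => /eqP->; move: z0; rewrite mxE.
move=> fx; exists (row_mx x (const_mx (f x))); last by rewrite row_mxKl.
by rewrite row_mxKl row_mxKr row_mxEr !mxE subrr.
Qed.

Lemma definable_lt n (f g : 'rV[R]_n -> R) :
  polynomial_fun f -> polynomial_fun g -> definable O [set x | f x < g x].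
Proof.
move=> pf pg; have := definable_gt0 (polynomial_funB pg pf).
by congr (definable O); apply/seteqP; split=> x /=; rewrite subr_gt0.
Qed.

Lemma definable_ge0 n (f : 'rV[R]_n -> R) :
  polynomial_fun f -> definable O [set x | 0 <= f x].
Proof.
move=> pf; have := definable_setC (definable_lt pf (polynomial_fun_cst n 0)).
congr (definable O); apply/seteqP; split=> x /=; rewrite leNgt => /negP //.
Qed.

Lemma definable_std_simplex n : definable O (@std_simplex R n).
Proof.
have := definable_forall (fun j => definable_gt0 (@polynomial_fun_bary n j)).
by rewrite -std_simplexE; congr (definable O).
Qed.

Lemma definable_closed_simplex n : definable O (@closed_simplex R n).
Proof.
exact: definable_forall (fun j => definable_ge0 (@polynomial_fun_bary n j)).
Qed.

Lemma definable_map_id n (A : set 'rV[R]_n) :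
  definable O A -> definable_map O A id.
Proof.
move=> dA; have diag : definable O [set z : 'rV[R]_(n + n) |
    forall i, z 0 (rshift n i) - z 0 (lshift n i) = 0].
  apply: definable_forall => i; apply: definable_eq0.
  exact: polynomial_funB (polynomial_fun_coord _) (polynomial_fun_coord _).
have := definable_setI (definable_setX dA (definableT n)) diag.
congr (definable O); apply/seteqP; split=> z /=.
  move=> [[Az _] zE]; split=> //; apply/rowP => i; rewrite !mxE.
  by apply/eqP; rewrite -subr_eq0 zE.
by move=> [Az /rowP zE]; split=> // i; have := zE i; rewrite !mxE => ->; rewrite subrr.
Qed.

End Definability.

(** * The bijection *)

Section StaircaseFamily.
Variables (R : realType) (O : o_minimal_structure R) (n : nat).

Lemma std_simplex_bounded : bounded_set (@std_simplex R n).
Proof.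
have [M [Mreal leM]] := compact_bounded (@closed_simplex_compact R n).
exists M; split=> // x /leM {}leM t tS; apply: leM.
by rewrite -closure_std_simplex; exact: subset_closure.
Qed.

Lemma definable_closure_std_simplex : definable O (closure (@std_simplex R n)).
Proof. by rewrite closure_std_simplex; exact: definable_closed_simplex. Qed.

Lemma std_simplex_homeomorphism : homeomorphism_on
  (closure (@std_simplex R n)) (closure (@std_simplex R n)) id.
Proof.
have cont : {within closure (@std_simplex R n), continuous id}.
  by apply: continuous_subspaceT => x; exact: cvg_id.
split=> //; first by split=> // x; exists x.
by exists id.
Qed.

Definition standard_simplex : ordered_simplex O n n :=
  OrderedSimplex std_simplex_bounded (definable_std_simplex O n)
    (definable_map_id definable_closure_std_simplex)
    std_simplex_homeomorphism (image_id _).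

Variable psi : boolfun n.
Hypothesis anti : antitone psi.

(** The same formula on the closed simplex provides the compact sets that a monotone family must be
    cut out by. *)
Lemma staircase_closed d : closed [set t : 'rV[R]_n |
  closed_simplex t /\ psi (bits (status [::] d t))].
Proof.
move=> p clp; split.
  by apply: closed_simplex_closed; apply: closureS clp => t [].
have [q [[_ psiq] /= near_q]] := clp _ (status_near [::] d p).
exact: antitone_bits psiq.
Qed.

Lemma staircase_definable : definable_family O (fun d => [set t : 'rV[R]_n |
  closed_simplex t /\ psi (bits (status [::] d t))]).
Proof.
have pd : polynomial_fun (fun z : 'rV[R]_(n + 1) => rsubmx z 0 0).
  have [p pE] := @polynomial_fun_coord R (n + 1) (rshift n 0).
  by exists p => z; rewrite mxE pE.
have pb j := polynomial_fun_lsubmx 1 (@polynomial_fun_bary R n j).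
apply: definable_setI; first exact: definable_gt0.
apply: definable_setI.
  have := definable_setX (definable_closed_simplex O n) (definableT O 1).
  by congr (definable O); apply/seteqP; split=> z // [].
apply: definable_boolfun => i.
set v := lift ord0 i.
suff dv : definable O [set z : 'rV[R]_(n + 1) | forall u : 'I_n.+1, (u < v)%N ->
    bary (lsubmx z) u < rsubmx z 0 0 * bary (lsubmx z) v].
  move: dv; congr (definable O); apply/seteqP.
  by split=> z /(statusP _ _ (isT : v \notin [::])).
apply: definable_forall => u; have [ltuv|leuv] := ltnP u v.
  have := definable_lt O (pb u) (polynomial_funM pd (pb v)).
  by congr (definable O); apply/seteqP; split=> z //= /(_ isT).
by have := definableT O (n + 1); congr (definable O); apply/seteqP; split.
Qed.

Lemma staircase_monotone :
  monotone_family standard_simplex (staircase psi [::]).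
Proof.
exists (@closed_simplex R n), (fun d => [set t : 'rV[R]_n |
  closed_simplex t /\ psi (bits (status [::] d t))]); split.
- split; [exact: closed_simplex_compact|exact: definable_closed_simplex|].
  by rewrite -closure_std_simplex; exact: subset_closure.
- move=> d _; split; last by move=> t [].
  apply: subclosed_compact (@closed_simplex_compact R n) _; last by move=> t [].
  exact: staircase_closed.
- exact: staircase_definable.
(* A smaller parameter makes each x_v harder to satisfy, as coordinates are nonnegative; fewer ones
   mean a larger set. *)
- near=> d => e e0 ed t [Kt psit]; split=> //; apply: antitone_bits psit => // v.
  move=> /(statusP _ _ (isT : v \notin [::])) H; apply/(statusP _ _ (isT : v \notin [::])) => u /H.
  by move/lt_le_trans; apply; rewrite ler_wpM2r // ltW.
- move=> d _; apply/seteqP; split=> t /=.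
    move=> [ft psit]; split; last by rewrite -std_simplexE.
    by split=> // j; exact: bary_ge0 ft.
  by move=> [[_ psit]]; rewrite -std_simplexE.
Unshelve. all: end_near. Qed.

Lemma face_standard js : face standard_simplex js = std_face js.
Proof. exact: image_id. Qed.

Lemma restr_staircase js d : 0 < d -> uniq js ->
  restr standard_simplex (staircase psi [::] d) js = staircase psi js d.
Proof.
move=> d0; elim/last_ind: js => [//|js k IHjs].
rewrite rcons_uniq => /andP[kjs ujs].
by rewrite restr_rcons IHjs // face_standard closure_staircase.
Qed.

Lemma near0_staircase_nonempty js : uniq js -> (size js <= n)%N ->
  \forall d \near 0^'+,
    restr standard_simplex (staircase psi [::] d) js !=set0 <->
    psi (bits (pattern js)).
Proof.
move=> ujs sjs; near=> d.
rewrite restr_staircase // staircase_nonempty //.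
by near: d; exact: nbhs_right_le.
Unshelve. all: end_near. Qed.

(** All traces being explicit, (A) holds because removing a vertex other than the lowest keeps the
    pattern, (B) is [staircase_full], (C) is [staircase_swap], and the value of psi at the pattern
    selects the alternative in (D). *)
Lemma staircase_hereditary js : uniq js -> (size js <= n)%N ->
  [/\ condA standard_simplex (staircase psi [::]) js,
      condB standard_simplex (staircase psi [::]) js,
      condC standard_simplex (staircase psi [::]) js &
      condD standard_simplex (staircase psi [::]) js].
Proof.
move=> ujs sjs.
have urcons j : (j + size js <= n)%N -> uniq (rcons js (vertex js j)).
  by move=> le_jn; rewrite rcons_uniq ujs vertex_notin.
split.
- near=> d.
  have d0 : 0 < d by [].
  have d1 : d <= 1 by near: d; exact: nbhs_right_le.
  rewrite restr_staircase // => /(staircase_nonempty anti ujs sjs d0 d1) psiZ j.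
  move=> /andP[j0]; rewrite leq_subRL // addnC => le_jn.
  rewrite restr_staircase ?urcons //; apply/staircase_nonempty => //.
  + exact: urcons.
  + by rewrite size_rcons; apply: leq_trans le_jn; rewrite -add1n leq_add2r.
  + suff -> : bits (pattern (rcons js (vertex js j))) = bits (pattern js) by [].
    by apply/ffunP => i; rewrite !ffunE pattern_rcons_vertex.
- rewrite /condB subn_gt0 => ltn; near=> d.
  rewrite !restr_staircase ?urcons // !face_standard.
  exact: staircase_full.
- near=> d; move=> l k /andP[lt_lk]; rewrite leq_subRL // addnC => le_kn neq.
  have le_ln : (l + size js <= n)%N by apply: leq_trans le_kn; rewrite leq_add2r ltnW.
  have neq_lk : vertex js l != vertex js k.
    by apply: contraTneq (vertex_lt ujs lt_lk le_kn) => ->; rewrite ltnn.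
  have uniq2 a b : vertex js a != vertex js b -> (a + size js <= n)%N ->
      (b + size js <= n)%N -> uniq (js ++ [:: vertex js a; vertex js b]).
    move=> neq_ab le_an le_bn.
    by rewrite cat_uniq ujs /= !inE !orbF neq_ab negb_or !vertex_notin.
  rewrite !restr_staircase ?uniq2 //; first exact: staircase_swap.
  by rewrite eq_sym.
- have [psiZ|npsiZ] := boolP (psi (bits (pattern js))); [right|left].
    near=> e; rewrite face_standard.
    rewrite -[RHS](staircase_interior anti psiZ (_ : 0 < e)) //.
    apply: eq_bigcupr => d /=; rewrite in_itv /= => /andP[d0 _].
    by rewrite restr_staircase.
  apply: filterS (near0_staircase_nonempty ujs sjs) => d ne.
  by apply: contrapT => /eqP/set0P/ne; apply/negP.
Unshelve. all: end_near. Qed.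

Definition staircase_family : mfamily O n :=
  MFamily staircase_monotone staircase_hereditary.

Lemma staircase_family_boolfun : boolfun_of staircase_family = psi.
Proof.
(* Initially nothing is removed and the lowest vertex is 0. *)
apply/funext => y; apply: (@boolval_pattern _ psi y _ n [::] ord0) => //.
- move=> js ujs sjs; have ne := near0_staircase_nonempty ujs (eq_leq sjs).
  apply/asboolP/idP => [ne'|psiZ].
    near (0:R)^'+ => d.
    have : restr standard_simplex (staircase psi [::] d) js !=set0 by near: d.
    suff H : restr standard_simplex (staircase psi [::] d) js !=set0 <->
        psi (bits (pattern js)) by move/H.
    by near: d.
  by apply: filterS ne => d ->.
- by rewrite addn0.
- by move=> v; rewrite in_nil leqn0 /= andbN.
- by move=> i j; rewrite add0n => ij; congr (y _); apply: val_inj.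
Unshelve. all: end_near. Qed.

End StaircaseFamily.

Lemma comb_class_inj (R : realType) (O : o_minimal_structure R) (n : nat)
    (F G : mfamily O n) :
  boolfun_of F = boolfun_of G -> comb_class F = comb_class G.
Proof.
move=> eqFG; apply/seteqP; split=> H /comb_equiv_boolfun eqH;
  by apply/comb_equiv_boolfun; rewrite -eqH.
Qed.

(** The first conjunct determines [Psi] on classes: it says that every family has exactly one
    Boolean function and that [Psi] takes its class to this function. *)
Theorem lemma6p16 (R : realType) (O : o_minimal_structure R) (n : nat) :
  exists Psi : set (mfamily O n) -> boolfun n,
    (forall (F : mfamily O n) (psi : boolfun n),
       is_boolfun F psi <-> Psi (comb_class F) = psi) /\
    set_bij (@comb_standard_classes R O n) (@lex_monotone n) Psi.
Proof.
(* Defined on arbitrary sets of families as the disjunction of the functions of their members; on a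
   combinatorial class all these functions agree. *)
pose Psi (C : set (mfamily O n)) : boolfun n :=
  fun x => `[< exists F, C F /\ boolfun_of F x >].
have PsiE F : Psi (comb_class F) = boolfun_of F.
  apply/funext => x; apply/asboolP/idP => [[G [/comb_equiv_boolfun->]]//|Fx].
  by exists F; split=> //; apply/comb_equiv_boolfun.
exists Psi; split=> [F psi|]; first by rewrite is_boolfunP PsiE; split=> ->.
split.
- by move=> _ [F [psi [-> /is_boolfunP-> lexpsi]]]; rewrite /= PsiE.
- move=> _ _ /set_mem[F [psi [-> _ _]]] /set_mem[G [psi' [-> _ _]]].
  by rewrite !PsiE; exact: comb_class_inj.
- move=> psi lexpsi; have anti := lex_monotone_antitone lexpsi.
  exists (comb_class (staircase_family O anti)); last first.
    by rewrite PsiE staircase_family_boolfun.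
  exists (staircase_family O anti), psi; split=> //.
  by apply/is_boolfunP; rewrite staircase_family_boolfun.
Qed.
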